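(* Let $G=\mathbb{Z}_v$ be a cyclic group of order $v$ and let $D=P-N\in\mathbb{Z}[G]$ be a signed set of $G$, with associated ternary sequence $S_D$ of period $v$. Then $D$ is a signed difference set with $\lambda=-1$ if and only if $S_D$ has two-level autocorrelation.
   Context: For a finite group $G$ of order $v$, with identity written $0_G$, a subset $S\subseteq G$ is identified with $\sum_{s\in S}s$ in the group ring $\mathbb{Z}[G]$. A signed set of $G$ is an element $D=\sum_{i=1}^k s_id_i\in\mathbb{Z}[G]$ with $d_1,\dots,d_k$ distinct elements of $G$ and $s_i\in\{-1,1\}$; its size is $k$. Put $P=\{d_i:s_i=1\}$ and $N=\{d_i:s_i=-1\}$, so $D=P-N$. Let $D^{-1}=\sum_i s_id_i^{-1}$. $D$ is a $(v,k,\lambda)$-signed difference set (SDS) if $DD^{-1}=\lambda G+(k-\lambda)\cdot 0_G$ in $\mathbb{Z}[G]$, where $\lambda$ is an integer. For $G=\mathbb{Z}_v=\{0,1,\dots,v-1\}$, the ternary sequence $S_D=(s_0,\dots,s_{v-1})$ is defined by $s_i=1$ if $i\in P$, $s_i=-1$ if $i\in N$, and $s_i=0$ if $i\notin P\cup N$. The periodic autocorrelation of $S=(s_0,\dots,s_{v-1})$ at shift $\tau$ is $C_S(\tau)=\sum_{i=0}^{v-1}s_{i+\tau}s_i^*$, $0\le\tau<v$, where $s_i^*$ is the complex conjugate of $s_i$ and indices are reduced modulo $v$. The sequence $S$ has two-level autocorrelation if $C_S(\tau)=-1$ for all $0<\tau<v$. *)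

(* Defs.v *)
From HB Require Import structures.
From mathcomp Require Import all_boot all_order all_algebra all_fingroup.

Set Implicit Arguments.
Unset Strict Implicit.
Unset Printing Implicit Defensive.

Import GRing.Theory Num.Theory.
Local Open Scope ring_scope.

(* The integral group ring Z[G] of a finite group. It is an alias of
   {ffun gT -> int} because the latter already carries the pointwise product. *)
Definition group_ring (gT : finGroupType) : Type := {ffun gT -> int}.

Section GroupRing.
Variable gT : finGroupType.
Implicit Types (x y z : group_ring gT) (g h : gT).

HB.instance Definition _ := GRing.Zmodule.copy (group_ring gT) {ffun gT -> int}.

Definition gr_coef x g : int := (x : {ffun gT -> int}) g.

Definition gr_elt g : group_ring gT := [ffun h => (h == g)%:R].

Definition gr_mul x y : group_ring gT :=
  [ffun g => \sum_h gr_coef x h * gr_coef y (h^-1 * g)%g].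

Lemma gr_mulA : associative gr_mul.
Proof.
move=> x y z; apply/ffunP=> g; rewrite !ffunE.
under eq_bigr => a _ do rewrite /gr_coef ffunE mulr_sumr.
under [RHS]eq_bigr => b _ do rewrite /gr_coef ffunE mulr_suml.
rewrite exchange_big [RHS]exchange_big [LHS]exchange_big /=.
apply: eq_bigr => a _; rewrite [RHS](reindex_inj (mulgI a)) /=.
by apply: eq_bigr => b _; rewrite mulrA mulKg invMg mulgA.
Qed.

Lemma gr_mul1l : left_id (gr_elt 1%g) gr_mul.
Proof.
move=> x; apply/ffunP=> g; rewrite ffunE (bigD1 1%g) //= /gr_coef ffunE eqxx.
rewrite mul1r invg1 mul1g big1 ?addr0 // => h /negPf h1.
by rewrite ffunE h1 mul0r.
Qed.

Lemma gr_mul1r : right_id (gr_elt 1%g) gr_mul.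
Proof.
move=> x; apply/ffunP=> g; rewrite ffunE (bigD1 g) //= /gr_coef ffunE mulVg eqxx.
rewrite mulr1 big1 ?addr0 // => h h1.
by rewrite ffunE -eq_mulVg1 (negPf h1) mulr0.
Qed.

Lemma gr_mulDl : left_distributive gr_mul +%R.
Proof.
move=> x y z; apply/ffunP=> g; rewrite !ffunE -big_split /=.
by apply: eq_bigr => h _; rewrite /gr_coef ffunE mulrDl.
Qed.

Lemma gr_mulDr : right_distributive gr_mul +%R.
Proof.
move=> x y z; apply/ffunP=> g; rewrite !ffunE -big_split /=.
by apply: eq_bigr => h _; rewrite /gr_coef ffunE mulrDr.
Qed.

Lemma gr_1neq0 : gr_elt 1%g != 0.
Proof. by apply/eqP => /ffunP/(_ 1%g); rewrite !ffunE eqxx. Qed.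

HB.instance Definition _ := GRing.Zmodule_isNzRing.Build (group_ring gT)
  gr_mulA gr_mul1l gr_mul1r gr_mulDl gr_mulDr gr_1neq0.

Lemma gr_eltM g h : gr_elt (g * h)%g = gr_elt g * gr_elt h.
Proof.
apply/ffunP=> a; rewrite !ffunE (bigD1 g) //= /gr_coef !ffunE eqxx mul1r.
rewrite big1 ?addr0 => [|b /negPf b1]; last by rewrite ffunE b1 mul0r.
by rewrite -(inj_eq (mulgI g) (g^-1 * a)%g) mulKVg.
Qed.

Definition gr_set (S : {set gT}) : group_ring gT := \sum_(g in S) gr_elt g.

End GroupRing.

Record signed_set (gT : finGroupType) := SignedSet {
  ss_size : nat;
  ss_elt : 'I_ss_size -> gT;
  ss_sign : 'I_ss_size -> int;
  ss_elt_inj : injective ss_elt;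
  ss_signP : forall i, ss_sign i = 1 \/ ss_sign i = -1
}.

Section SignedSet.
Variables (gT : finGroupType) (D : signed_set gT).

Definition ss_val : group_ring gT :=
  \sum_(i < ss_size D) gr_elt (ss_elt i) *~ ss_sign i.

Definition ss_inv : group_ring gT :=
  \sum_(i < ss_size D) gr_elt (ss_elt i)^-1%g *~ ss_sign i.

Definition ss_pos : {set gT} := [set ss_elt i | i : 'I_(ss_size D) & ss_sign i == 1].

Definition ss_neg : {set gT} := [set ss_elt i | i : 'I_(ss_size D) & ss_sign i == -1].

Lemma ss_valE : ss_val = gr_set ss_pos - gr_set ss_neg.
Proof.
rewrite /ss_val /gr_set !big_imset /=; try by move=> i j _ _; apply: ss_elt_inj.
rewrite (bigID (fun i => ss_sign i == 1)) /=; congr (_ + _).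
  by apply: eq_big => [i|i /eqP->]; rewrite ?inE ?mulr1z.
rewrite -sumrN; apply: eq_big => [i|i].
  by rewrite !inE; case: (ss_signP i) => ->.
by case: (ss_signP i) => -> //; rewrite mulrN1z.
Qed.

Definition is_SDS (v k : nat) (lambda : int) : Prop :=
  [/\ #|gT| = v, ss_size D = k &
      ss_val * ss_inv
        = gr_set [set: gT] *~ lambda + gr_elt 1%g *~ (k%:Z - lambda)].

End SignedSet.

(* The cyclic group Z_v, for v = n.+1, is 'I_n.+1, whose canonical finGroupType
   law is addition modulo n.+1. *)

Definition ternary_seq (C : numClosedFieldType) (n : nat)
    (D : signed_set 'I_n.+1) (i : 'I_n.+1) : C :=
  if i \in ss_pos D then 1 else if i \in ss_neg D then -1 else 0.

(* inZp reduces the index i + tau modulo n.+1. *)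
Definition autocorrelation (C : numClosedFieldType) (n : nat)
    (s : 'I_n.+1 -> C) (tau : nat) : C :=
  \sum_(i < n.+1) s (inZp (i + tau)) * (s i)^*.

Definition two_level_autocorrelation (C : numClosedFieldType) (n : nat)
    (s : 'I_n.+1 -> C) : Prop :=
  forall tau : nat, (0 < tau < n.+1)%N -> autocorrelation s tau = -1.

(* Main.v *)
Require Import Defs.
From mathcomp Require Import all_boot all_order all_algebra all_fingroup.

(* The coefficient of D D^-1 at g is \sum_h D(gh) D(h): at the identity this is
   the size k of D, as the coefficients of D are signs on its support, and in
   Z_v at g = tau it is the autocorrelation of S_D at shift tau. Comparing
   coefficients with -G + (k + 1) 0_G gives the equivalence. *)

Import GRing.Theory Num.Theory.
Local Open Scope ring_scope.

Section Coefficients.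
Variable gT : finGroupType.
Implicit Types (x y : group_ring gT) (g h : gT) (S : {set gT}).

Lemma gr_coefD x y g : gr_coef (x + y) g = gr_coef x g + gr_coef y g.
Proof. by rewrite /gr_coef ffunE. Qed.

Lemma gr_coefB x y g : gr_coef (x - y) g = gr_coef x g - gr_coef y g.
Proof. by rewrite /gr_coef !ffunE. Qed.

Lemma gr_coef_sum (I : Type) (r : seq I) (P : pred I)
    (F : I -> group_ring gT) g :
  gr_coef (\sum_(i <- r | P i) F i) g = \sum_(i <- r | P i) gr_coef (F i) g.
Proof.
apply: (big_morph ((@gr_coef gT)^~ g)) => [x y|]; first exact: gr_coefD.
by rewrite /gr_coef ffunE.
Qed.

Lemma gr_coefMz x (m : int) g : gr_coef (x *~ m) g = gr_coef x g *~ m.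
Proof.
have coefMn k : gr_coef (x *+ k) g = gr_coef x g *+ k.
  by elim: k => [|k IH]; rewrite ?mulr0n ?mulrS ?gr_coefD ?IH // /gr_coef ffunE.
case: m => k; first by rewrite -!pmulrn coefMn.
(* An opposite is read as a difference [0 - _], so that [gr_coefB] reduces the negative case to
   natural multiples. *)
by rewrite NegzE !mulrNz -!pmulrn -[- _]add0r gr_coefB coefMn /gr_coef ffunE add0r.
Qed.

Lemma gr_coef_elt h g : gr_coef (gr_elt h) g = (g == h)%:R.
Proof. by rewrite /gr_coef ffunE. Qed.

Lemma gr_coef_set S g : gr_coef (gr_set S) g = (g \in S)%:R.
Proof.
rewrite gr_coef_sum.
under eq_bigr do rewrite gr_coef_elt.
have [gS|gS] := boolP (g \in S).
  rewrite (bigD1 g) //= eqxx big1 ?addr0 // => h /andP[_].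
  by rewrite eq_sym => /negPf->.
by rewrite big1 // => h hS; case: eqP gS => // ->; rewrite hS.
Qed.

End Coefficients.

Section SignedSetCoefficients.
Variables (gT : finGroupType) (D : signed_set gT).
Implicit Types g h : gT.

Lemma ss_val_coef g :
  gr_coef (ss_val D) g = \sum_(i < ss_size D) (g == ss_elt i)%:R *~ ss_sign i.
Proof.
rewrite gr_coef_sum; apply: eq_bigr => i _.
by rewrite gr_coefMz gr_coef_elt.
Qed.

Lemma ss_inv_coef g : gr_coef (ss_inv D) g = gr_coef (ss_val D) g^-1%g.
Proof.
rewrite ss_val_coef gr_coef_sum /=; apply: eq_bigr => i _.
by rewrite gr_coefMz gr_coef_elt -eq_invg_sym eq_sym.
Qed.

Lemma ss_val_coef_elt (i : 'I_(ss_size D)) :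
  gr_coef (ss_val D) (ss_elt i) = ss_sign i.
Proof.
rewrite ss_val_coef (bigD1 i) //= eqxx big1 ?addr0 ?intz // => j ji.
by rewrite (inj_eq (@ss_elt_inj _ D)) eq_sym (negPf ji) mul0rz.
Qed.

(** Substituting [g * h] for the convolution variable turns the second factor into the coefficient
    of D at [h], since [ss_inv] reads D at inverses. This is the shape of an autocorrelation sum. *)
Lemma ss_mul_inv_coef g :
  gr_coef (ss_val D * ss_inv D) g
    = \sum_h gr_coef (ss_val D) (g * h)%g * gr_coef (ss_val D) h.
Proof.
rewrite /gr_coef ffunE (reindex_inj (mulgI g)); apply: eq_bigr => h _.
by rewrite ss_inv_coef invMg invgK mulKg.
Qed.

Lemma ss_mul_inv_coef1 : gr_coef (ss_val D * ss_inv D) 1%g = (ss_size D)%:Z.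
Proof.
rewrite ss_mul_inv_coef.
(* Only one factor of the square is expanded: after the exchange of sums, index [i] contributes only
   at [h = ss_elt i], where it gives the square of a sign, hence 1. *)
under eq_bigr => h _ do rewrite mul1g [X in _ * X]ss_val_coef mulr_sumr.
rewrite exchange_big /= (eq_bigr (fun=> 1)) => [|i _].
  by rewrite sumr_const card_ord natz.
rewrite (bigD1 (ss_elt i)) //= big1 ?addr0 => [|h /negPf->].
  by rewrite eqxx intz ss_val_coef_elt; case: (ss_signP i) => ->.
by rewrite mul0rz mulr0.
Qed.

(** By injectivity of [ss_elt] an element carries a single sign. Hence the order of the tests in
    [ternary_seq] does not affect its values. *)
Lemma ss_pos_neg_disjoint g : g \in ss_pos D -> (g \in ss_neg D) = false.
Proof.
case/imsetP=> i; rewrite inE => /eqP si ->; apply/negP => /imsetP[j].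
by rewrite inE => /eqP sj /ss_elt_inj ij; rewrite -ij si in sj.
Qed.

(** At the identity the equation holds automatically: the right side is [lambda + (k - lambda)], and
    the left side is the size of D. Only the coefficients away from the identity impose a
    condition. *)
Lemma is_SDS_coef v k (lambda : int) :
  is_SDS D v k lambda <->
  [/\ #|gT| = v, ss_size D = k &
      forall g, g != 1%g ->
        \sum_h gr_coef (ss_val D) (g * h)%g * gr_coef (ss_val D) h = lambda].
Proof.
have rhsE g : gr_coef (gr_set [set: gT] *~ lambda
                       + gr_elt 1%g *~ (k%:Z - lambda)) g
              = lambda + (g == 1%g)%:R *~ (k%:Z - lambda).
  by rewrite gr_coefD !gr_coefMz gr_coef_set gr_coef_elt inE intz.
split=> -[cardG sizeD DD]; split=> //.
  by move=> g /negPf g1; rewrite -ss_mul_inv_coef DD rhsE g1 mul0rz addr0.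
apply/ffunP=> g; rewrite -!/(gr_coef _ g) rhsE.
have [->|g1] := eqVneq g 1%g; last by rewrite ss_mul_inv_coef DD // mul0rz addr0.
by rewrite ss_mul_inv_coef1 sizeD intz addrC subrK.
Qed.

End SignedSetCoefficients.

Lemma ternary_seqE (C : numClosedFieldType) n (D : signed_set 'I_n.+1) i :
  ternary_seq C D i = (gr_coef (ss_val D) i)%:~R.
Proof.
rewrite /ternary_seq ss_valE gr_coefB !gr_coef_set.
by case: ifP => [/ss_pos_neg_disjoint->|_] //; case: ifP.
Qed.

Lemma autocorrelation_ternary_seq (C : numClosedFieldType) n
    (D : signed_set 'I_n.+1) (g : 'I_n.+1) :
  autocorrelation (ternary_seq C D) g
    = (\sum_h gr_coef (ss_val D) (g * h)%g * gr_coef (ss_val D) h)%:~R.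
Proof.
rewrite rmorph_sum; apply: eq_bigr => h _.
(* The conjugation disappears because the entries are integers. *)
rewrite !ternary_seqE rmorphM /= rmorph_int; congr ((gr_coef _ _)%:~R * _).
by apply: val_inj; rewrite /= addnC.
Qed.

Theorem lemma2p3 (C : numClosedFieldType) (n : nat) (D : signed_set 'I_n.+1) :
  is_SDS D n.+1 (ss_size D) (-1) <->
  two_level_autocorrelation (ternary_seq C D).
Proof.
apply: (iff_trans (is_SDS_coef _ D _ _ _)).
split=> [[_ _ DD] tau /andP[tau_gt0 tau_lt]|corr].
  (* The shift is below the order, so it is an element of the group; being positive, it differs from
     the identity 0. *)
  rewrite (autocorrelation_ternary_seq C n D (Ordinal tau_lt)) DD ?rmorphN1 //.
  by rewrite -val_eqE -lt0n.
split=> [||g g1]; rewrite ?card_ord //.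
(* The hypothesis lives in [C]; characteristic 0 brings it back to integers. *)
apply: (@intr_inj C); rewrite -autocorrelation_ternary_seq corr ?rmorphN1 //.
by rewrite ltn_ord lt0n andbT.
Qed.
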